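(* Let $V=W_1\oplus W_2$ be a finite-dimensional vector space over the non-archimedean field $F$, with $W_1,W_2$ nonzero subspaces, and let $\Lambda,\Lambda'\subset V$ be $\mathcal{O}$-lattices. Then $\Lambda$ and $\Lambda'$ are in the same orbit of $\mathrm{GL}(W_1)\times\mathrm{GL}(W_2)$ if and only if $Q(\Lambda)=Q(\Lambda')$ (equality of isomorphism classes of $\mathcal{O}$-modules).
   Context: $F$ is a non-archimedean field (with a discrete valuation and finite residue field), $\mathcal{O}$ its ring of integers, $\varpi$ a fixed uniformizer. An $\mathcal{O}$-lattice in a finite-dimensional $F$-vector space is a finitely generated free $\mathcal{O}$-submodule that spans the space over $F$. The group $\mathrm{GL}(W_1)\times\mathrm{GL}(W_2)$ is viewed as the subgroup of $\mathrm{GL}(V)$ preserving both $W_1$ and $W_2$, and acts on lattices in $V$ by $\Lambda\mapsto g\Lambda$. Let $p_i:V\to W_i$ ($i=1,2$) be the projections for the decomposition $V=W_1\oplus W_2$. For a lattice $\Lambda\subset V$ put $P_i(\Lambda)=p_i(\Lambda)$ and $K_i(\Lambda)=\Lambda\cap W_i$; these are lattices in $W_i$ with $K_i(\Lambda)\subset P_i(\Lambda)$. Put $Q_i(\Lambda)=P_i(\Lambda)/K_i(\Lambda)$, a finite $\mathcal{O}$-module. One has $Q_1(\Lambda)\cong Q_2(\Lambda)$ as $\mathcal{O}$-modules, and $Q(\Lambda)$ denotes this common isomorphism class. *)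

(* Defs.v *)
(* MathComp, with the classical axioms of mathcomp.classical.boolp for
   membership in the image of a lattice. *)
From HB Require Import structures.
From mathcomp Require Import all_boot all_order all_algebra.
From mathcomp Require Import boolp.

Set Implicit Arguments.
Unset Strict Implicit.
Unset Printing Implicit Defensive.

Import Order.TTheory GRing.Theory Num.Theory.
Local Open Scope ring_scope.

(* The value at 0 is meaningless (it stands for +oo): no axiom constrains it
   and no definition below depends on it. *)
Record discrete_valuation (F : fieldType) := DiscreteValuation {
  valuation :> F -> int;
  valuationM : forall x y, x != 0 -> y != 0 ->
    valuation (x * y) = valuation x + valuation y;
  valuationD : forall x y, x != 0 -> y != 0 -> x + y != 0 ->
    Num.min (valuation x) (valuation y) <= valuation (x + y);
  valuation_uniformizer : exists2 pi, pi != 0 & valuation pi = 1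
}.

Section Integers.
Variables (F : fieldType) (v : discrete_valuation F).

Definition integer_pred : {pred F} := [pred x | (x == 0) || (0 <= v x)].

Lemma valuation1 : v 1 = 0.
Proof.
have := valuationM v (oner_neq0 F) (oner_neq0 F).
by rewrite mulr1 => /eqP; rewrite -subr_eq0 opprD addNKr oppr_eq0 => /eqP.
Qed.

Lemma valuationN x : v (- x) = v x.
Proof.
have N1 : (-1 : F) != 0 by rewrite oppr_eq0 oner_neq0.
have vN1 : v (-1) = 0.
  have := valuationM v N1 N1; rewrite mulrNN mulr1 valuation1 => /eqP.
  by rewrite eq_sym -mulr2n mulrn_eq0 => /eqP.
have [->|x0] := eqVneq x 0; first by rewrite oppr0.
by rewrite -mulN1r valuationM // vN1 add0r.
Qed.

Lemma integer_subring_closed : subring_closed integer_pred.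
Proof.
split=> [|x y|x y]; rewrite !inE.
- by rewrite valuation1 lexx orbT.
- have [->|x0] := eqVneq x 0.
    by rewrite sub0r oppr_eq0 valuationN.
  have [->|y0] := eqVneq y 0.
    by rewrite subr0 (negPf x0).
  rewrite /= => vx vy; have [//|xy0 /=] := eqVneq (x - y) 0.
  rewrite -oppr_eq0 in y0.
  by apply: le_trans (valuationD v x0 y0 xy0); rewrite le_min vx valuationN.
have [->|x0] := eqVneq x 0; first by rewrite mul0r eqxx.
have [->|y0] := eqVneq y 0; first by rewrite mulr0 eqxx.
by move=> /= vx vy; rewrite valuationM // addr_ge0 ?orbT.
Qed.

HB.instance Definition _ :=
  GRing.isSubringClosed.Build F integer_pred integer_subring_closed.

Definition integers : Type := {x : F | x \in integer_pred}.
HB.instance Definition _ := SubChoice.on integers.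
HB.instance Definition _ :=
  [SubChoice_isSubComNzRing of integers by <:].

Lemma maximal_ideal_axiom (a x y : F) : a \in integer_pred ->
  (x == 0) || (0 < v x) -> (y == 0) || (0 < v y) ->
  (a * x + y == 0) || (0 < v (a * x + y)).
Proof.
rewrite inE; have [->|a0] := eqVneq a 0; first by rewrite mul0r add0r.
have [->|x0] := eqVneq x 0; first by rewrite mulr0 add0r.
have [->|y0] /= := eqVneq y 0.
  by move=> va vx _; rewrite addr0 valuationM // ltr_wpDl ?orbT.
move=> va vx vy; have [//|s0 /=] := eqVneq (a * x + y) 0.
apply: lt_le_trans (valuationD v _ y0 s0); last by rewrite mulf_neq0.
by rewrite lt_min vy andbT valuationM // ltr_wpDl.
Qed.

Definition maximal_ideal : {pred integers} :=
  [pred x : integers | (val x == 0) || (0 < v (val x))].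

Lemma maximal_ideal_closed : idealr_closed maximal_ideal.
Proof.
split=> [||a x y]; rewrite !inE.
- by rewrite raddf0 eqxx.
- by rewrite rmorph1 valuation1 ltxx oner_eq0.
exact: maximal_ideal_axiom (valP a).
Qed.

HB.instance Definition _ :=
  isIdealr.Build integers maximal_ideal maximal_ideal_closed.

Definition residue_field := {ideal_quot maximal_ideal}.

Definition finite_residue_field : Prop :=
  exists s : seq residue_field, forall x, x \in s.

End Integers.

Section ModuleQuotient.
Variables (R : pzRingType) (M : lmodType R) (S : submodClosed M).
Import Quotient.
Local Open Scope quotient_scope.

(* A copy of S that is canonically a zmodClosed, as Quotient.quot requires. *)
Definition submod_pred : {pred M} := S.
HB.instance Definition _ := GRing.isSubmodClosed.Build R M submod_pred
  (submodClosedP S).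

Definition mod_quot : Type := Quotient.quot submod_pred.
HB.instance Definition _ := ZmodQuotient.on mod_quot.
HB.instance Definition _ := Choice.on mod_quot.

Definition quot_scale (a : R) := lift_op1 mod_quot ( *:%R a).

Lemma pi_scale a : {morph \pi_mod_quot : x / a *: x >-> quot_scale a x}.
Proof.
move=> x; unlock quot_scale; apply/eqP.
rewrite -[_ == _](idealrBE submod_pred) -scalerBr rpredZ //.
by rewrite (idealrBE submod_pred) reprK.
Qed.

Lemma quot_scaleA a b (x : mod_quot) :
  quot_scale a (quot_scale b x) = quot_scale (a * b) x.
Proof. by rewrite -[x]reprK -!pi_scale scalerA. Qed.

Lemma quot_scale1 : left_id 1 quot_scale.
Proof. by move=> x; rewrite -[x]reprK -pi_scale scale1r. Qed.

Lemma quot_scaleDr : right_distributive quot_scale +%R.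
Proof.
move=> a x y; rewrite -[x]reprK -[y]reprK.
by rewrite -!pi_scale -!(raddfD \pi_mod_quot) -pi_scale scalerDr.
Qed.

Lemma quot_scaleDl (x : mod_quot) : {morph quot_scale^~ x : a b / a + b}.
Proof.
by move=> a b; rewrite -[x]reprK -!pi_scale -(raddfD \pi_mod_quot) scalerDl.
Qed.

HB.instance Definition _ := GRing.Zmodule_isLmodule.Build R mod_quot
  quot_scaleA quot_scale1 quot_scaleDr quot_scaleDl.

Lemma mod_quot_pi_linear : linear (\pi_mod_quot : M -> mod_quot).
Proof.
move=> a x y; rewrite (raddfD \pi_mod_quot); congr (_ + _).
exact: pi_scale.
Qed.

Lemma mod_quot_pi_eq0 x : (\pi_mod_quot x == 0 :> mod_quot) = (x \in S).
Proof.
by rewrite -(raddf0 \pi_mod_quot) -[_ == _](idealrBE submod_pred) subr0.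
Qed.

End ModuleQuotient.

Section Subquotient.
Variables (R : pzRingType) (M : lmodType R) (P K : submodClosed M).

Definition submodule : Type := {x : M | x \in P}.
HB.instance Definition _ := SubChoice.on submodule.
HB.instance Definition _ := [SubChoice_isSubLmodule of submodule by <:].

Definition submod_trace : {pred submodule} := [pred x : submodule | val x \in K].

Lemma submod_trace_closed : submod_closed submod_trace.
Proof.
split=> [|a x y]; rewrite !inE ?raddf0 ?rpred0 // => Kx Ky.
have -> : val (a *: x + y) = a *: val x + val y by [].
by rewrite rpredD ?rpredZ.
Qed.

HB.instance Definition _ :=
  GRing.isSubmodClosed.Build R submodule submod_trace submod_trace_closed.

(* P / (P :&: K); this is P / K when K is contained in P. *)
Definition subquot : lmodType R := mod_quot submod_trace.

End Subquotient.

Definition mod_iso (R : pzRingType) (M N : lmodType R) : Prop :=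
  exists f : {linear M -> N}, bijective f.

Lemma mod_iso_common_source (R : pzRingType) (L M N : lmodType R)
    (f : {linear L -> M}) (g : {linear L -> N}) :
  (forall y, exists x, f x == y) -> (forall y, exists x, g x == y) ->
  (forall x, (f x == 0) = (g x == 0)) -> mod_iso M N.
Proof.
move=> fS gS ker; pose h y := g (xchoose (fS y)).
pose k z := f (xchoose (gS z)).
have hf x : h (f x) = g x.
  apply/eqP; rewrite -subr_eq0 -raddfB -ker raddfB subr_eq0.
  exact: (xchooseP (fS (f x))).
have kg x : k (g x) = f x.
  apply/eqP; rewrite -subr_eq0 -raddfB ker raddfB subr_eq0.
  exact: (xchooseP (gS (g x))).
have hL : linear h.
  move=> a y1 y2.
  rewrite -(eqP (xchooseP (fS y1))) -(eqP (xchooseP (fS y2))).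
  by rewrite -linearP !hf linearP.
pose hm := GRing.isLinear.Build R M N *:%R h hL.
pose H : {linear M -> N} := HB.pack h hm.
exists H; exists k => y /=.
  by rewrite -(eqP (xchooseP (fS y))) hf kg.
by rewrite -(eqP (xchooseP (gS y))) kg hf.
Qed.

(* V, seen as a module over the ring of integers of v. *)
Definition restrict_scalars (F : fieldType) (v : discrete_valuation F)
  (V : vectType F) : Type := V.

Section Lattices.
Variables (F : fieldType) (v : discrete_valuation F) (V : vectType F).
Local Notation O := (integers v).
Local Notation VO := (restrict_scalars v V).

HB.instance Definition _ := GRing.Zmodule.copy VO V.

Definition restrict_scale (a : O) (x : VO) : VO := (val a : F) *: (x : V).

Lemma restrict_scaleA a b x :
  restrict_scale a (restrict_scale b x) = restrict_scale (a * b) x.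
Proof. by rewrite /restrict_scale rmorphM scalerA. Qed.

Lemma restrict_scale1 : left_id 1 restrict_scale.
Proof. by move=> x; rewrite /restrict_scale rmorph1 scale1r. Qed.

Lemma restrict_scaleDr : right_distributive restrict_scale +%R.
Proof. by move=> a x y; rewrite /restrict_scale scalerDr. Qed.

Lemma restrict_scaleDl x : {morph restrict_scale^~ x : a b / a + b}.
Proof. by move=> a b; rewrite /restrict_scale rmorphD scalerDl. Qed.

HB.instance Definition _ := GRing.Zmodule_isLmodule.Build O VO
  restrict_scaleA restrict_scale1 restrict_scaleDr restrict_scaleDl.

Definition is_free_of_finite_rank (L : submodClosed VO) : Prop :=
  exists (n : nat) (e : 'I_n -> VO), (forall i, e i \in L) /\
    forall x, x \in L -> exists! c : {ffun 'I_n -> O}, x = \sum_i c i *: e i.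

Definition spans (L : submodClosed VO) : Prop :=
  exists2 s : seq V, {subset s <= L} & <<s>>%VS = fullv.

Definition is_lattice (L : submodClosed VO) : Prop :=
  is_free_of_finite_rank L /\ spans L.

Definition lat_image (g : 'End(V)) (L : {pred VO}) : {pred VO} :=
  [pred x : VO | `[< exists2 y : VO, y \in L & g y = x >]].

Definition lat_cap (W : {vspace V}) (L : {pred VO}) : {pred VO} :=
  [pred x : VO | (x \in L) && ((x : V) \in W)].

Section Submodules.
Variables (g : 'End(V)) (W : {vspace V}) (L : submodClosed VO).

Lemma lat_image_closed : submod_closed (lat_image g L).
Proof.
split=> [|a x y]; rewrite !inE.
  by apply/asboolP; exists 0; rewrite ?rpred0 ?linear0.
move=> /asboolP[x' Lx' <-] /asboolP[y' Ly' <-]; apply/asboolP.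
by exists (a *: x' + y'); rewrite ?rpredD ?rpredZ // linearD linearZ.
Qed.

HB.instance Definition _ :=
  GRing.isSubmodClosed.Build O VO (lat_image g L) lat_image_closed.

Lemma lat_cap_closed : submod_closed (lat_cap W L).
Proof.
split=> [|a x y]; rewrite !inE ?rpred0 ?mem0v //.
move=> /andP[Lx Wx] /andP[Ly Wy]; rewrite rpredD ?rpredZ //=.
by rewrite memvD ?memvZ.
Qed.

HB.instance Definition _ :=
  GRing.isSubmodClosed.Build O VO (lat_cap W L) lat_cap_closed.

End Submodules.

Section Decomposition.
(* U stands for one of the two summands of V, and W for the other one;
   daddv_pi U W is the projection onto U along W. *)
Variables (U W : {vspace V}) (L : submodClosed VO).

Definition lat_P : submodClosed VO := lat_image (daddv_pi U W) L.
Definition lat_K : submodClosed VO := lat_cap U L.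
Definition lat_Q : lmodType O := subquot lat_P lat_K.

End Decomposition.

Section QSymmetry.
Variables (U W : {vspace V}) (L : submodClosed VO).

Lemma lat_P_proof (x : submodule L) : daddv_pi U W (val x) \in lat_P U W L.
Proof. by rewrite inE; apply/asboolP; exists (val x) => //; apply: valP. Qed.

Definition lat_Q_pi (x : submodule L) : lat_Q U W L :=
  \pi_(mod_quot _)%qT (Sub (daddv_pi U W (val x)) (lat_P_proof x)
    : submodule (lat_P U W L)).

Lemma lat_Q_pi_linear : linear lat_Q_pi.
Proof.
move=> a x y; rewrite /lat_Q_pi -mod_quot_pi_linear; congr (\pi_(_)%qT _).
apply: val_inj.
exact: (linearP (daddv_pi U W) (val a : F) (val x : V) (val y : V)).
Qed.

HB.instance Definition _ := GRing.isLinear.Build O (submodule L)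
  (lat_Q U W L) *:%R lat_Q_pi lat_Q_pi_linear.

Lemma lat_Q_pi_surj (q : lat_Q U W L) : exists x, lat_Q_pi x == q.
Proof.
rewrite -[q]reprK; set y := repr q.
have := valP y; rewrite inE => /asboolP[x Lx xy].
exists (Sub x Lx); apply/eqP; congr (\pi_(_)%qT _).
exact: val_inj.
Qed.

Lemma lat_Q_pi_eq0 (x : submodule L) :
  (lat_Q_pi x == 0) = (daddv_pi U W (val x) \in (L : {pred VO})).
Proof. by rewrite [LHS]mod_quot_pi_eq0 !inE /= memv_pi andbT. Qed.

End QSymmetry.

(* Q_1 and Q_2 are isomorphic, so either represents the class Q. *)
Lemma lat_Q_sym (U W : {vspace V}) (L : submodClosed VO) :
  (U + W = fullv)%VS -> (U :&: W = 0)%VS -> mod_iso (lat_Q U W L) (lat_Q W U L).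
Proof.
move=> UW dUW.
apply: (mod_iso_common_source (f := lat_Q_pi U W (L := L))
  (g := lat_Q_pi W U (L := L))); try exact: lat_Q_pi_surj.
move=> x; rewrite !lat_Q_pi_eq0.
have e : (val x : V) = daddv_pi U W (val x) + daddv_pi W U (val x).
  by rewrite daddv_pi_add // UW memvf.
have Lx := valP x.
apply/idP/idP => H.
  have -> : daddv_pi W U (val x) = (val x : VO) - (daddv_pi U W (val x) : VO).
    by rewrite [X in X - _]e addrC addKr.
  exact: (rpredB (S := submod_pred L) Lx H).
have -> : daddv_pi U W (val x) = (val x : VO) - (daddv_pi W U (val x) : VO).
  by rewrite [X in X - _]e addrK.
exact: (rpredB (S := submod_pred L) Lx H).
Qed.

End Lattices.

(* GL(W1) x GL(W2) as a subgroup of GL(V), where V = W1 (+) W2. *)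
Definition GL_prod (F : fieldType) (V : vectType F) (W1 W2 : {vspace V}) :
  {pred 'End(V)} :=
  [pred g | [&& lker g == 0%VS, (g @: W1)%VS == W1 & (g @: W2)%VS == W2]].

Definition same_orbit (F : fieldType) (v : discrete_valuation F)
  (V : vectType F) (W1 W2 : {vspace V})
  (L L' : submodClosed (restrict_scalars v V)) : Prop :=
  exists2 g : 'End(V), g \in GL_prod W1 W2 & L' =i lat_image g L.

(* Main.v *)
From HB Require Import structures.
Require Import Defs.
From mathcomp Require Import all_boot all_order all_algebra.
From mathcomp Require Import boolp.

(* Modulo K1 (+) K2, a lattice L is the graph of an isomorphism Q1 -> Q2, so L
   is recovered from P1, P2 and the maps L -> Q1, L -> Q2. It therefore suffices
   to lift an isomorphism between quotients of two lattices P, P' of the same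
   rank to an isomorphism P -> P'. Any lift h of it to a linear map P -> P'
   satisfies h(P) + K' = P'; modulo the maximal ideal, h can be corrected by a
   map with values in K' into an invertible one, and by Nakayama (a determinant)
   the corrected map is invertible over the ring of integers. *)

Set Implicit Arguments.
Unset Strict Implicit.
Unset Printing Implicit Defensive.

Import Order.TTheory GRing.Theory Num.Theory.
Local Open Scope ring_scope.

(** * Matrices over a field: correction to an invertible matrix *)

(** Induction on the corank of [H]: while [H] is singular, some row of [B] lies outside its row
    space, and adding a rank-one multiple of that row to [H] raises the rank. *)
Lemma unitmx_add_mul (k : fieldType) (m n : nat) (H : 'M[k]_n) (B : 'M_(m, n)) :
  row_full (H + B)%MS -> exists X : 'M_(n, m), H + X *m B \in unitmx.
Proof.
have [d] := ubnP (n - \rank H); elim: d H => // d IHd H ltd HB.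
have [Hfull | Hnfull] := boolP (row_full H).
  by exists 0; rewrite mul0mx addr0 -row_full_unit.
have [i BiH] : exists i, ~~ (row i B <= H)%MS.
  apply/existsP; apply: contraR Hnfull => /existsPn BH.
  rewrite -sub1mx (submx_trans (_ : _ <= H + B)%MS) ?sub1mx //.
  by rewrite addsmx_sub submx_refl; apply/row_subP => i; rewrite -[_ _ _]negbK.
have /rowV0Pn[u uH u0] : kermx H != 0.
  by rewrite kermx_eq0 -row_leq_rank -ltnNge ltn_neqAle rank_leq_row andbT.
have {}uH : u *m H = 0 by apply/sub_kermxP.
have [c uc] : exists c : 'cV_n, u *m c = 1%:M.
  by apply/row_freeP; rewrite -row_leq_rank rank_rV u0.
(* As u H = 0 and u c = 1, adding c b to H makes b = u (H + c b) a combination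
   of the rows, so the rank grows. *)
pose X0 : 'M_(n, m) := c *m delta_mx 0 i.
pose H1 := H + X0 *m B.
have H1E : H1 = H + c *m row i B by rewrite /H1 -mulmxA -rowE.
have biH' : (row i B <= H1)%MS.
  apply/submxP; exists u.
  by rewrite H1E mulmxDr uH add0r mulmxA uc mul1mx.
have HH' : (H <= H1)%MS.
  rewrite -[X in (X <= _)%MS](addrK (c *m row i B)) -H1E addmx_sub // -mulNmx.
  exact: submx_trans (submxMl _ _) biH'.
have ltH : (\rank H < \rank H1)%N.
  rewrite ltn_neqAle mxrankS // andbT; apply: contra BiH => /eqP eqr.
  apply: submx_trans biH' _.
  by rewrite -(geq_leqif (mxrank_leqif_sup HH')) eqr.
have [|| X HX] := IHd H1.
- rewrite -ltnS; apply: leq_trans ltd; rewrite ltnS ltn_sub2l //.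
  exact: leq_trans ltH (rank_leq_row _).
- move: HB; rewrite -!sub1mx => /submx_trans; apply; rewrite addsmxS //.
by exists (X0 + X); rewrite mulmxDl addrA.
Qed.

(** * The residue field, and lifting invertibility from it to the ring of integers *)

Section ResidueField.
Variables (F : fieldType) (v : discrete_valuation F).
Local Notation O := (integers v).
Local Notation k := (residue_field v).
Import Quotient.
Local Open Scope quotient_scope.

(** The inverse has valuation [- v a], and [v a <= 0] for a nonzero element outside the maximal
    ideal. *)
Lemma integer_inv (a : O) : a \notin @maximal_ideal F v ->
  (val a)^-1 \in integer_pred v.
Proof.
rewrite inE negb_or => /andP[a0 va]; have := valP a; rewrite !inE (negPf a0) /=.
have := valuationM v a0 (invr_neq0 a0); rewrite divff // valuation1.
move=> /eqP; rewrite eq_sym addrC addr_eq0 => /eqP-> va0.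
by rewrite oppr_ge0 leNgt va orbT.
Qed.

HB.instance Definition _ := GRing.ComNzRing.on k.
HB.instance Definition _ := NzRingQuotient.on k.

(** For [q] nonzero, [integer_inv] applies to the chosen representative, so [insubd] does not fall
    back on its default 0. *)
Definition residue_inv (q : k) : k :=
  if q == 0 then 0 else \pi_k (insubd (0 : O) (val (repr q))^-1).

Lemma residue_pi_eq0 (a : O) : (\pi_k a == 0) = (a \in @maximal_ideal F v).
Proof.
by rewrite -(raddf0 \pi_k) -[_ == _](idealrBE (@maximal_ideal F v)) subr0.
Qed.

Lemma residue_mulVf (q : k) : q != 0 -> residue_inv q * q = 1.
Proof.
move=> q0; rewrite /residue_inv (negPf q0).
have qE : q = \pi_k (repr q) by rewrite reprK.
have qm : repr q \notin @maximal_ideal F v by rewrite -residue_pi_eq0 -qE.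
rewrite {2}qE -(rmorphM \pi_k) -(rmorph1 \pi_k); congr \pi.
apply: val_inj; rewrite rmorphM rmorph1 /= insubdK ?mulVf ?integer_inv //.
by move: qm; rewrite inE negb_or => /andP[].
Qed.

Lemma residue_inv0 : residue_inv 0 = 0.
Proof. by rewrite /residue_inv eqxx. Qed.

HB.instance Definition _ :=
  GRing.ComNzRing_isField.Build k residue_mulVf residue_inv0.

(** As [C *m H] and [1%:M - C *m H] add up to the identity, [H] and [1%:M - C *m H] together have
    full row space over the residue field, where [unitmx_add_mul] applies. Any lift [X] of the
    correction will do: the determinant is then a unit. *)
Lemma integer_mx_stable_range (n : nat) (C H : 'M[O]_n) :
  exists X Y, Y *m (H + X *m (1%:M - C *m H)) = 1%:M.
Proof.
pose p := map_mx (\pi_k).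
have [|Xk] := @unitmx_add_mul k n n (p n n H) (p n n (1%:M - C *m H)).
  rewrite -sub1mx.
  have -> : 1%:M = p n n C *m p n n H + p n n (1%:M - C *m H).
    by rewrite /p -map_mxM -map_mxD addrC subrK map_mx1.
  by apply: addmx_sub_adds; rewrite ?submxMl.
pose X := map_mx (@repr _ k) Xk.
have -> : Xk = p n n X by apply/matrixP=> i j; rewrite !mxE reprK.
rewrite /p -map_mxM -map_mxD unitmxE det_map_mx unitfE residue_pi_eq0.
set M := _ + _ => dM.
(* The inverse of [M] by Cramer's rule; [\det M] lies outside the maximal ideal, so its inverse is
   an integer. *)
exists X, ((insubd (0 : O) (val (\det M))^-1) *: \adj M).
rewrite -scalemxAl mul_adj_mx scale_scalar_mx.
congr _%:M.
apply: val_inj; rewrite rmorphM rmorph1 /= insubdK ?mulVf ?integer_inv //.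
by move: dM; rewrite inE negb_or => /andP[].
Qed.

End ResidueField.

(** * Bases of lattices, and lifting isomorphisms of their quotients *)

Section Generation.
Variables (F : fieldType) (v : discrete_valuation F) (V : vectType F).
Local Notation O := (integers v).
Local Notation VO := (restrict_scalars v V).

Lemma submod_sum (P : submodClosed VO) (I : Type) (r : seq I) (c : I -> O)
    (y : I -> V) :
  (forall i, (y i : VO) \in P) -> (\sum_(i <- r) val (c i) *: y i : VO) \in P.
Proof.
move=> Py; apply: (@rpred_sum VO P) => i _.
exact: (@rpredZ O VO P (c i) (y i)).
Qed.

(** Coefficients are indexed by vectors rather than positions, so they keep their meaning when a
    vector is removed from [s]. *)
Definition generates (P : submodClosed VO) (s : seq V) : Prop :=
  {subset s <= P} /\
  forall x : V, (x : VO) \in P ->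
    exists c : V -> O, x = \sum_(y <- s) val (c y) *: y.

(* A relation among generators, divided by its coefficient of least valuation,
   expresses one generator through the others. *)
Lemma generates_rem (P : submodClosed VO) (s : seq V) : uniq s ->
  generates P s -> ~~ free s -> exists2 x, x \in s & generates P (rem x s).
Proof.
move=> us [sP Pgen] /(negP : ~~ free (in_tuple s) -> _) nfree.
have [k k0 [i0 ki0]] : exists2 k : 'I_(size s) -> F,
    \sum_i k i *: s`_i = 0 & exists i, k i != 0.
  apply: contra_notP nfree => Nk; apply/freeP => k k0 i; apply/eqP.
  by apply: contra_notT Nk => ki; exists k => //; exists i.
have [j kj jmin] := @Order.TotalTheory.arg_minP _ int _ i0 [pred i | k i != 0]
  (fun i => v (k i)) ki0.
have kint i : (- (k i / k j)) \in integer_pred v.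
  rewrite rpredN inE mulf_eq0 invr_eq0 (negPf kj) orbF.
  have [//|ki /=] := eqVneq (k i) 0.
  have kj' := invr_neq0 kj.
  have := valuationM v kj kj'; rewrite divff // valuation1 => /esym/eqP.
  rewrite addrC addr_eq0 valuationM // => /eqP->.
  by rewrite subr_ge0 jmin.
(* The relation divided by [- k j]: the coefficient of the vector of index [j] becomes -1, and the
   others stay integral because [j] minimizes the valuation. Vectors outside [s] get the default
   0. *)
pose d (y : V) : O := if insub (index y s) is Some i
  then Sub (- (k i / k j)) (kint i) else 0.
have dE (i : 'I_(size s)) : val (d s`_i) = - (k i / k j).
  rewrite /d index_uniq // insubT ?ltn_ord // => ilt /=.
  by congr (- (k _ / _)); apply: val_inj.
have js : s`_j \in s by rewrite mem_nth.
have sjE : s`_j = \sum_(y <- rem s`_j s) val (d y) *: y.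
  have : \sum_(y <- s) val (d y) *: y = 0.
    transitivity (- (k j)^-1 *: \sum_i k i *: s`_i); last by rewrite k0 scaler0.
    rewrite (big_nth 0) big_mkord scaler_sumr.
    by apply: eq_bigr => i _; rewrite dE scalerA mulNr mulrC.
  rewrite (big_rem _ js) dE /= divff // scaleN1r => /eqP.
  by rewrite addrC subr_eq0 => /eqP.
exists s`_j => //; split=> [x /mem_rem/sP//|x /Pgen[c ->]].
exists (fun y => c s`_j * d y + c y).
rewrite (big_rem _ js) /= {2}sjE scaler_sumr -big_split /=.
by apply: eq_bigr => y _; rewrite scalerA -scalerDl.
Qed.

Lemma generates_free (P : submodClosed VO) (s : seq V) : uniq s ->
  generates P s -> exists2 e, generates P e & free e.
Proof.
have [n] := ubnP (size s); elim: n s => // n IHn s ltsn us sP.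
have [fs|nfs] := boolP (free s); first by exists s.
have [x xs xP] := generates_rem us sP nfs.
apply: IHn (xP); last exact: rem_uniq.
by rewrite size_rem // -ltnS prednK ?(leq_trans _ ltsn) //; case: (s) xs.
Qed.

(** The projections of a basis of [L] generate; a free subfamily still does, and it spans [U]
    because [L] spans [V]. The length [\dim U] does not depend on [L], so two lattices get bases of
    equal size. *)
Lemma lat_P_basis (U W : {vspace V}) (L : submodClosed VO) :
  (U :&: W = 0)%VS -> is_lattice L ->
  exists2 e : (\dim U).-tuple V, basis_of U e & generates (lat_P U W L) e.
Proof.
move=> dUW [[n [b [bL Lb]]] [t tL tV]].
pose p := daddv_pi U W; pose pb := [seq p (b i) | i : 'I_n].
have PP (x : VO) : x \in L -> (p x : VO) \in lat_P U W L.
  by move=> Lx; rewrite inE; apply/asboolP; exists x.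
have gen : generates (lat_P U W L) (undup pb).
  split=> [x|x]; first by rewrite mem_undup => /mapP[i _ ->]; apply/PP/bL.
  rewrite inE => /asboolP[y /Lb[c [-> _]] <-].
  (* Distinct basis vectors may have the same projection; their coefficients are added. *)
  exists (fun z => \sum_(i | p (b i) == z) c i).
  rewrite (linear_sum p).
  transitivity (\sum_i \sum_(z <- undup pb | p (b i) == z) val (c i) *: z).
    apply: eq_bigr => i _; rewrite linearZ /=.
    rewrite -big_filter -(eq_filter (a1 := pred1 (p (b i)))).
      rewrite filter_pred1_uniq ?undup_uniq ?big_seq1 // mem_undup.
      by apply: map_f; rewrite mem_enum.
    by move=> z; rewrite /= eq_sym.
  rewrite (exchange_big_dep xpredT) //; apply: eq_bigr => z _.
  by rewrite rmorph_sum scaler_suml.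
have [e [eP Pe] fe] := generates_free (undup_uniq pb) gen.
have eU : <<e>>%VS = U.
  apply/subv_anti/andP; split.
    apply/span_subvP => x /eP; rewrite inE => /asboolP[y _ <-]; exact: memv_pi.
  have -> : U = (p @: <<t>>)%VS.
    apply/subv_anti/andP; rewrite tV; split; apply/subvP => x.
      by move=> Ux; apply/memv_imgP; exists x; rewrite ?memvf ?daddv_pi_id.
    by move=> /memv_imgP[y _ ->]; apply: memv_pi.
  rewrite limg_span; apply/span_subvP => _ /mapP[x /tL/PP/Pe[c ->] ->].
  rewrite big_seq; apply: memv_suml => y ey.
  exact/memvZ/memv_span.
have se : size e == \dim U by rewrite -eU eq_sym.
by exists (Tuple se); rewrite // /basis_of /= eU eqxx.
Qed.

(** Coordinates are row vectors, so a map between lattices acts on them by right multiplication by a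
    matrix. *)
Definition comb n (e : n.-tuple V) (c : 'rV[O]_n) : V :=
  \sum_i val (c 0 i) *: e`_i.

Lemma comb_is_linear n (e : n.-tuple V) :
  linear (comb e : 'rV[O]_n -> VO).
Proof.
move=> a c d; rewrite /comb (scaler_sumr a) -big_split.
by apply: eq_bigr => i _; rewrite !mxE rmorphD rmorphM scalerDl -scalerA.
Qed.
HB.instance Definition _ n e := GRing.isLinear.Build O 'rV[O]_n VO *:%R
  (@comb n e) (@comb_is_linear n e).

Lemma generates_comb (P : submodClosed VO) n (e : n.-tuple V) (x : V) :
  generates P e -> (x : VO) \in P -> exists c, x = comb e c.
Proof.
move=> [_ gen] /gen[c ->]; exists (\row_i c e`_i).
rewrite (big_nth 0) big_mkord size_tuple.
by apply: eq_bigr => i _; rewrite mxE.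
Qed.

Lemma combD n (e : n.-tuple V) c d : comb e (c + d) = comb e c + comb e d.
Proof. exact: (raddfD (comb e : {linear _ -> VO})). Qed.

Lemma combB n (e : n.-tuple V) c d : comb e (c - d) = comb e c - comb e d.
Proof. exact: (raddfB (comb e : {linear _ -> VO})). Qed.

Lemma comb_row1 n (e : n.-tuple V) i : comb e (row i 1%:M) = e`_i.
Proof.
rewrite /comb (bigD1 i) // big1 => [|j ji].
  by rewrite [LHS]addr0 !mxE eqxx rmorph1 scale1r.
by rewrite !mxE eq_sym (negPf ji) rmorph0 scale0r.
Qed.

Lemma comb_mulmx n m (e : n.-tuple V) (c : 'rV[O]_m) (M : 'M[O]_(m, n)) :
  comb e (c *m M) = \sum_i val (c 0 i) *: comb e (row i M).
Proof.
rewrite mulmx_sum_row (linear_sum (comb e : {linear _ -> VO})).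
by apply: eq_bigr => i _; rewrite (linearZ_LR (comb e : {linear _ -> VO})).
Qed.

(* [R] plays the role of the graph, pulled back to [P] and [P'], of an
   isomorphism between quotients of [P] and [P']. *)
Lemma lift_relation (U : {vspace V}) (P P' : submodClosed VO)
    (e e' : (\dim U).-tuple V) (R : V -> V -> Prop) :
  basis_of U e -> basis_of U e' -> generates P e -> generates P' e' ->
  R 0 0 ->
  (forall (a : O) x y x' y', R x y -> R x' y' ->
     R (val a *: x + x') (val a *: y + y')) ->
  (forall x : V, (x : VO) \in P -> exists2 y : V, (y : VO) \in P' & R x y) ->
  (forall y : V, (y : VO) \in P' -> exists2 x : V, (x : VO) \in P & R x y) ->
  exists g : 'End(V), [/\ (g @: U <= U)%VS,
    forall x : V, (x : VO) \in P -> R x (g x) &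
    forall y : V, (y : VO) \in P' -> exists2 x : V, (x : VO) \in P & g x = y].
Proof.
move=> be be' gP gP' R0 RL RP RP'.
have Rsum (I : finType) (c : I -> O) (x y : I -> V) :
    (forall i, R (x i) (y i)) ->
    R (\sum_i val (c i) *: x i) (\sum_i val (c i) *: y i).
  by move=> Rxy; apply: (big_ind2 R) => // [x1 x2 y1 y2 R1 R2|i _];
     [have := RL 1 _ _ _ _ R1 R2; rewrite rmorph1 !scale1r
     |have := RL (c i) _ _ _ _ (Rxy i) R0; rewrite !addr0].
have Re (i : 'I_(\dim U)) : exists h, R e`_i (comb e' h).
  have [|y /(generates_comb gP')[h ->] Rh] := RP e`_i; last by exists h.
  by apply: (proj1 gP); rewrite mem_nth // size_tuple.
have Re' (i : 'I_(\dim U)) : exists c, R (comb e c) e'`_i.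
  have [|y /(generates_comb gP)[c ->] Rc] := RP' e'`_i; last by exists c.
  by apply: (proj1 gP'); rewrite mem_nth // size_tuple.
have [h Rh] := fin_all_exists Re.
have [c Rc] := fin_all_exists Re'.
(* The rows of [H] are coordinates of partners in [P'] of the vectors of [e]; those of [C], of
   partners in [P] of the vectors of [e']. *)
pose H := \matrix_i h i; pose C := \matrix_i c i.
have [X [Y YM]] := integer_mx_stable_range C H.
set B := 1%:M - C *m H in YM; set M := H + X *m B in YM.
(* The vector of index [i] in [e'] and the one with coordinates [row i (C *m H)] are both partners
   of [comb e (c i)], so their difference is a partner of 0. *)
have RB (i : 'I_(\dim U)) : R 0 (comb e' (row i B)).
  have := Rsum _ (C i) (fun i : 'I_(\dim U) => e`_i)
    (fun i => comb e' (row i H)).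
  have /[swap] /[apply] : forall j : 'I_(\dim U), R e`_j (comb e' (row j H)).
    by move=> j; rewrite rowK.
  have -> : \sum_j val (C i j) *: e`_j = comb e (c i).
    by apply: eq_bigr => j _; rewrite mxE.
  have -> : \sum_j val (C i j) *: comb e' (row j H) = comb e' (row i (C *m H)).
    rewrite row_mul comb_mulmx; apply: eq_bigr => j _.
    by rewrite [row i C _ _]mxE.
  move=> /(RL (-1)) /(_ (Rc i)); rewrite rmorphN1 !scaleN1r addNr.
  have -> : - comb e' (row i (C *m H)) + e'`_i = comb e' (row i B) => //.
  by rewrite /B raddfB combB comb_row1 addrC.
(* The correction [X *m B] combines partners of 0, so the rows of [M] still give partners of the
   vectors of [e]. *)
have RM (i : 'I_(\dim U)) : R e`_i (comb e' (row i M)).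
  have := Rsum _ (X i) (fun=> 0) (fun j => comb e' (row j B)) RB.
  rewrite big1 => [|j _]; last by rewrite scaler0.
  have -> : \sum_j val (X i j) *: comb e' (row j B) = comb e' (row i (X *m B)).
    by rewrite row_mul comb_mulmx; apply: eq_bigr => j _; rewrite mxE.
  move=> /(RL 1 _ _ _ _ (Rh i)); rewrite rmorph1 !scale1r addr0.
  by rewrite -[h i](rowK h) -combD -raddfD.
have [f fE] := linear_of_free e [seq comb e' (row i M) | i : 'I_(\dim U)].
have {fE}fE (i : 'I_(\dim U)) : f e`_i = comb e' (row i M).
  have := fE (basis_free be); rewrite size_map -cardE card_ord size_tuple.
  move=> /(_ erefl) /(congr1 (nth 0 ^~ i)).
  rewrite (nth_map 0) ?size_tuple // => ->.
  rewrite (nth_map i) -?cardE ?card_ord //; congr (comb _ (row _ _)).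
  exact: nth_ord_enum.
have gc (d : 'rV[O]_(\dim U)) : linfun f (comb e d) = comb e' (d *m M).
  rewrite lfunE /= comb_mulmx linear_sum; apply: eq_bigr => i _.
  by rewrite linearZ /= fE.
exists (linfun f); split.
- rewrite -(span_basis be) limg_span; apply/span_subvP => _ /mapP[x ex ->].
  rewrite (span_basis be).
  have [i ->] : exists i : 'I_(\dim U), x = e`_i.
    have ix : (index x e < \dim U)%N.
      by rewrite -[ltnRHS](size_tuple e) index_mem.
    by exists (Ordinal ix); rewrite nth_index.
  rewrite lfunE /= fE; apply: memv_suml => j _; apply: memvZ.
  by apply: (basis_mem be'); rewrite mem_nth ?size_tuple.
- move=> x /(generates_comb gP)[d ->]; rewrite gc comb_mulmx.
  exact: Rsum.
(* Since [Y *m M] is the identity, [d *m Y] is a preimage of [d] with integral coordinates. *)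
move=> y /(generates_comb gP')[d ->]; exists (comb e (d *m Y)).
  apply: submod_sum => i.
  by apply: (proj1 gP); rewrite mem_nth // size_tuple.
by rewrite gc -mulmxA YM mulmx1.
Qed.

End Generation.

(** * Gluing projections, and invariance of the quotient along an orbit *)

Section Orbits.
Variables (F : fieldType) (v : discrete_valuation F) (V : vectType F).
Local Notation O := (integers v).
Local Notation VO := (restrict_scalars v V).
Variables (U W : {vspace V}).
Hypotheses (sumUW : (U + W)%VS = fullv) (dUW : (U :&: W)%VS = 0%VS).
Implicit Types L : submodClosed VO.

Lemma daddv_pi_addE (x : V) : daddv_pi U W x + daddv_pi W U x = x.
Proof. by rewrite daddv_pi_add // sumUW memvf. Qed.

Lemma daddv_pi_eq0 (x : V) : x \in W -> daddv_pi U W x = 0.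
Proof.
move=> Wx; apply: (addIr (daddv_pi W U x)).
by rewrite daddv_pi_addE add0r daddv_pi_id // capvC.
Qed.

Lemma lat_Q_pi_eq L (a b : submodule L) :
  (lat_Q_pi U W a = lat_Q_pi U W b) <->
  (daddv_pi U W (val a) - daddv_pi U W (val b) : VO) \in L.
Proof.
have E : (lat_Q_pi U W (a - b) == 0) = (lat_Q_pi U W a == lat_Q_pi U W b).
  by rewrite raddfB subr_eq0.
have -> : daddv_pi U W (val a) - daddv_pi U W (val b) =
    daddv_pi U W (val (a - b)).
  by rewrite -linearB.
rewrite -[X in _ <-> is_true X]lat_Q_pi_eq0 E; exact: rwP eqP.
Qed.

(** The glued vector is [val b] plus the difference of the two projections to [U]. As in Goursat's
    lemma, this decides membership in [M] from the two components alone. *)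
Lemma lat_Q_pi_eq_glue (M : submodClosed VO) (a b : submodule M) :
  (lat_Q_pi U W a = lat_Q_pi U W b) <->
  (daddv_pi U W (val a) + daddv_pi W U (val b) : VO) \in M.
Proof.
rewrite lat_Q_pi_eq.
have -> : daddv_pi U W (val a) + daddv_pi W U (val b) =
  (daddv_pi U W (val a) - daddv_pi U W (val b)) + val b :> V.
  by rewrite -{3}(daddv_pi_addE (val b)) addrA subrK.
split=> H; first exact: (@rpredD VO M _ _ H (valP b)).
rewrite -[X in X \in _](@addrK VO (val b)).
exact: (rpredB (S := submod_pred M) H (valP b)).
Qed.

(** An element [g] of the group commutes with the projections, so the class of [x] and the class of
    [g x] define two surjections from [L] with the same kernel. *)
Lemma same_orbit_mod_iso L L' :
  same_orbit U W L L' -> mod_iso (lat_Q U W L) (lat_Q U W L').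
Proof.
case=> g /and3P[/lker0P g_inj /eqP gU /eqP gW] gL.
have gpi x : daddv_pi U W (g x) = g (daddv_pi U W x).
  have gi A B (y : V) : (g @: A)%VS = A -> g (daddv_pi A B y) \in A.
    by move=> {2}<-; apply/memv_img/memv_pi.
  rewrite -{1}[x]daddv_pi_addE !linearD /= daddv_pi_id ?gi //.
  by rewrite (daddv_pi_eq0 (gi W U _ gW)) addr0.
have gP (x : submodule L) : (g (val x) : VO) \in L'.
  by rewrite gL inE; apply/asboolP; exists (val x) => //; apply: valP.
pose h (x : submodule L) : lat_Q U W L' :=
  lat_Q_pi U W (Sub (g (val x)) (gP x) : submodule L').
have hL : linear h.
  move=> a x y; rewrite /h -linearP; congr lat_Q_pi; apply: val_inj.
  exact: (linearP g (val a : F) (val x : V) (val y : V)).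
pose hm := GRing.isLinear.Build O (submodule L) (lat_Q U W L') *:%R h hL.
pose H : {linear submodule L -> lat_Q U W L'} := HB.pack h hm.
apply: (mod_iso_common_source (f := lat_Q_pi U W (L := L)) (g := H)).
- exact: lat_Q_pi_surj.
- move=> q; have [y /eqP <-] := lat_Q_pi_surj q.
  have := valP y; rewrite gL inE => /asboolP[x Lx gx].
  exists (Sub x Lx); apply/eqP; congr lat_Q_pi; exact: val_inj.
move=> x; rewrite [RHS]lat_Q_pi_eq0 lat_Q_pi_eq0 /= gpi gL inE.
apply/idP/asboolP => [Lx|[y Ly /g_inj <-//]].
by exists (daddv_pi U W (val x)).
Qed.

End Orbits.

(** * From an isomorphism of quotients to an element of the group *)

Section Converse.
Variables (F : fieldType) (v : discrete_valuation F) (V : vectType F).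
Local Notation O := (integers v).
Local Notation VO := (restrict_scalars v V).
Variables (U W : {vspace V}).
Hypotheses (sumUW : (U + W)%VS = fullv) (dUW : (U :&: W)%VS = 0%VS).
Variables (L L' : submodClosed VO).
Hypotheses (latL : is_lattice L) (latL' : is_lattice L').
Variable phi : {linear lat_Q U W L -> lat_Q U W L'}.
Hypothesis phi_bij : bijective phi.

Definition Q_related (a : submodule L) (b : submodule L') : Prop :=
  phi (lat_Q_pi U W a) = lat_Q_pi U W b.

(** [Q_related] compares elements of [L] and [L'] themselves, so it can be projected to either
    summand: the same [phi] yields compatible lifts for [(U, W)] and for [(W, U)]. *)
Lemma lift_Q_related (A B : {vspace V}) : (A :&: B)%VS = 0%VS ->
  exists g : 'End(V), [/\ (g @: A <= A)%VS,
    forall x : V, (x : VO) \in lat_P A B L ->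
      exists a b, [/\ Q_related a b, daddv_pi A B (val a) = x
                    & daddv_pi A B (val b) = g x] &
    forall y : V, (y : VO) \in lat_P A B L' ->
      exists2 x : V, (x : VO) \in lat_P A B L & g x = y].
Proof.
move=> dAB; have [e be gen] := lat_P_basis dAB latL.
have [e' be' gen'] := lat_P_basis dAB latL'.
pose R (x y : V) := exists a b, [/\ Q_related a b, daddv_pi A B (val a) = x
                    & daddv_pi A B (val b) = y].
apply: (lift_relation (R := R) be be' gen gen').
- by exists 0, 0; rewrite /Q_related !linear0; split=> //; apply: linear0.
- move=> c x y x' y' [a [b [ab <- <-]]] [a' [b' [ab' <- <-]]].
  exists (c *: a + a'), (c *: b + b'); split.
  + by rewrite /Q_related !linearP ab ab'.
  + exact: (linearP (daddv_pi A B) (val c : F) (val a : V) (val a' : V)).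
  + exact: (linearP (daddv_pi A B) (val c : F) (val b : V) (val b' : V)).
- move=> x; rewrite inE => /asboolP[a La <-].
  have [b /eqP ab] :=
    lat_Q_pi_surj (phi (lat_Q_pi U W (Sub a La : submodule L))).
  exists (daddv_pi A B (val b)); first exact: lat_P_proof.
  by exists (Sub a La), b.
move=> y; rewrite inE => /asboolP[b Lb <-].
have [psi phiK psiK] := phi_bij.
have [a /eqP ab] :=
  lat_Q_pi_surj (psi (lat_Q_pi U W (Sub b Lb : submodule L'))).
exists (daddv_pi A B (val a)); first exact: lat_P_proof.
by exists a, (Sub b Lb); rewrite /Q_related ab psiK.
Qed.

(** The lifts on the two summands are assembled into [g]; since both come from [phi], the gluing
    criterion for [L] is carried to the one for [L']. *)
Lemma mod_iso_same_orbit : same_orbit U W L L'.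
Proof.
have dWU : (W :&: U)%VS = 0%VS by rewrite capvC.
have glue := lat_Q_pi_eq_glue sumUW dUW.
have [g1 [g1U g1R g1S]] := lift_Q_related dUW.
have [g2 [g2W g2R g2S]] := lift_Q_related dWU.
pose p1 := daddv_pi U W; pose p2 := daddv_pi W U.
pose g : 'End(V) := (g1 \o p1)%VF + (g2 \o p2)%VF.
have gE x : g x = g1 (p1 x) + g2 (p2 x) by rewrite add_lfunE !comp_lfunE.
have p1U x : x \in U -> p1 x = x by apply: daddv_pi_id.
have p2W x : x \in W -> p2 x = x by apply: daddv_pi_id.
have p2U x : x \in U -> p2 x = 0.
  by apply: daddv_pi_eq0; rewrite // addvC.
have p1W x : x \in W -> p1 x = 0 by apply: daddv_pi_eq0.
have gU x : x \in U -> g x = g1 x.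
  by move=> Ux; rewrite gE p1U ?p2U ?linear0 ?addr0.
have gW x : x \in W -> g x = g2 x.
  by move=> Wx; rewrite gE p2W ?p1W ?linear0 ?add0r.
have PL (M : submodClosed VO) A B (x : V) :
    (x : VO) \in M -> (daddv_pi A B x : VO) \in lat_P A B M.
  by move=> Mx; rewrite inE; apply/asboolP; exists x.
(* The components of [x] come from [a1] and [a2], which have the same class because they glue to
   [x]. Hence [b1] and [b2] have the same class and glue to [g x]. *)
have gL x : (x : VO) \in L -> (g x : VO) \in L'.
  move=> Lx; rewrite gE.
  have [a1 [b1 [ab1 a1x <-]]] := g1R _ (PL _ U W _ Lx).
  have [a2 [b2 [ab2 a2x <-]]] := g2R _ (PL _ W U _ Lx).
  apply/glue; rewrite -ab1 -ab2.
  apply: (congr1 phi); apply/glue.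
  by rewrite a1x a2x daddv_pi_addE.
have gS y : (y : VO) \in L' -> exists2 x : VO, x \in L & g x = y.
  move=> Ly; have [x1 Px1 x1y] := g1S _ (PL _ U W _ Ly).
  have [x2 Px2 x2y] := g2S _ (PL _ W U _ Ly).
  have [a1 [b1 [ab1 a1x b1y]]] := g1R _ Px1.
  have [a2 [b2 [ab2 a2x b2y]]] := g2R _ Px2.
  have Ux : x1 \in U by rewrite -a1x memv_pi.
  have Wx : x2 \in W by rewrite -a2x memv_pi.
  exists (x1 + x2 : V).
    2: by rewrite linearD /= gU ?gW // x1y x2y daddv_pi_addE.
  (* The gluing argument runs backwards from [L'] to [L] by injectivity of [phi]. *)
  rewrite -a1x -a2x; apply/glue; apply: (bij_inj phi_bij).
  rewrite ab1 ab2; apply/glue.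
  by rewrite b1y b2y x1y x2y daddv_pi_addE.
(* The image of [g] contains [L'], which spans [V]; so [g] is onto, hence injective by dimension. *)
have ker0 : lker g = 0%VS.
  have [_ [t tL tV]] := latL'.
  have gV : (g @: fullv)%VS = fullv.
    apply/eqP; rewrite eqEsubv subvf /=.
    rewrite -[X in (X <= _)%VS]tV; apply/span_subvP => y /tL/gS[x _ <-].
    exact: (memv_img g (memvf (x : V))).
  have := limg_ker_dim g fullv; rewrite gV capfv => /eqP.
  by rewrite -[X in _ == X]add0n eqn_add2r dimv_eq0 => /eqP.
have gA A : (g @: A <= A)%VS -> (g @: A)%VS == A.
  by move=> gA; rewrite eqEdim gA limg_dim_eq ?leqnn ?ker0 ?capv0.
exists g.
  apply/and3P; split; first exact/eqP.
    apply: gA; apply/subvP => _ /memv_imgP[x Ux ->]; rewrite gU //.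
    exact/(subvP g1U)/memv_img.
  apply: gA; apply/subvP => _ /memv_imgP[x Wx ->]; rewrite gW //.
  exact/(subvP g2W)/memv_img.
move=> y; rewrite inE; apply/idP/asboolP => [/gS//|[x Lx <-]]; exact: gL.
Qed.

End Converse.

Theorem theorem2p4 (F : fieldType) (v : discrete_valuation F)
  (finF : finite_residue_field v) (V : vectType F) (W1 W2 : {vspace V})
  (sumW : (W1 + W2)%VS = fullv) (capW : (W1 :&: W2)%VS = 0%VS)
  (W1_neq0 : W1 <> 0%VS) (W2_neq0 : W2 <> 0%VS)
  (L L' : submodClosed (restrict_scalars v V))
  (latL : is_lattice L) (latL' : is_lattice L') :
  same_orbit W1 W2 L L' <-> mod_iso (lat_Q W1 W2 L) (lat_Q W1 W2 L').
Proof.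
split=> [|[phi phi_bij]]; first exact: same_orbit_mod_iso.
exact: mod_iso_same_orbit phi_bij.
Qed.
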